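(* Let $F$ be a finite field of characteristic $2$, let $n\ge1$, and let $B=(b_{ij})_{1\le i,j\le4}$ be a $4\times4$ matrix over $F$ with $b_{44}=0$. Consider the $2^n\times2^n\times2^n\times2^n$ hypercube made of bricks $B$, with one of the following boundary conditions applied to the fourth dimension: (a) periodic; (b) fourth input all zeros, fourth output free. Assume that $$(b_{12}+b_{14}b_{42})(b_{23}+b_{24}b_{43})(b_{31}+b_{34}b_{41})\ne(b_{13}+b_{14}b_{43})(b_{32}+b_{34}b_{42})(b_{21}+b_{24}b_{41})$$ in case (a), and $b_{13}b_{21}b_{32}\ne b_{12}b_{23}b_{31}$ in case (b). Then the hypercube stratifies into $2^n$ independent three-dimensional layers, and each layer is gauge equivalent to the direct sum of $2^{2n-1}+2^{n-1}$ matrices $\tilde B$ and $2^{2n-1}-2^{n-1}$ matrices $\tilde B^{\mathrm T}$, where $$\tilde B=\begin{cases}\bigl((b_{ij}+b_{i4}b_{4j})^{2^n}\bigr)_{1\le i,j\le3}&\text{in case (a)},\\ \bigl(b_{ij}^{2^n}\bigr)_{1\le i,j\le3}&\text{in case (b)}.\end{cases}$$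
   Context: Conventions: vectors are rows and operators/matrices act from the right. Hypercube. Let $N=2^n$ and $C=\{\mathbf x\in\mathbb Z^4:0\le x_i\le N-1\}$. Consider all lines parallel to the coordinate axes through points of $C$; the points of $C$ divide them into edges directed along the axes, so at each vertex $\mathbf x\in C$ there is one incoming and one outgoing edge in each of the four directions. A permitted configuration assigns an element of $F$ (''spin'') to each edge so that at each $\mathbf x\in C$ the row of four incoming spins (in directions 1,2,3,4) is mapped by $B$ to the row of four outgoing spins. The $i$-th input (output) consists of the spins on the half-infinite edges parallel to the $i$-th axis that enter (leave) $C$. Boundary conditions on the fourth dimension: (a) each spin in the fourth output equals the spin in the fourth input on the same line; (b) all spins in the fourth input are zero and the fourth output is unrestricted. Under either boundary condition (with $b_{44}=0$), the spins on edges parallel to axis 4 can be eliminated: the inputs in directions 1, 2, 3 determine all spins, and hence determine a linear operator $R$ sending the inputs in directions 1,2,3 to the outputs in directions 1,2,3. $R$ acts in $\mathbf V_1\oplus\mathbf V_2\oplus\mathbf V_3$, where the thick space $\mathbf V_i$ is the direct sum of the copies of $F$ attached to the $N^3$ lines parallel to the $i$-th axis. Gauge equivalence is conjugation of $R$ by a block-diagonal matrix $\mathrm{diag}(g_1,g_2,g_3)$, $g_i\in\mathrm{Aut}\,\mathbf V_i$, i.e. a change of basis in each thick space. ''Stratifies into $2^n$ independent 3d layers'' means that each $\mathbf V_i$ is a direct sum of $2^n$ subspaces $\mathbf V_i^{(1)},\dots,\mathbf V_i^{(2^n)}$, each of dimension $4^n$, such that $R$ preserves each $\mathbf V_1^{(k)}\oplus\mathbf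 V_2^{(k)}\oplus\mathbf V_3^{(k)}$; the restriction of $R$ to the latter is a layer. A layer is a direct sum of $3\times3$ matrices $M_1,M_2,\dots$ if there are bases $\{v_m^{(i)}\}_m$ of its three spaces ($i=1,2,3$) in which it acts by $v_m^{(i)}\mapsto\sum_{j}(M_m)_{ij}v_m^{(j)}$. *)

(* Defs.v *)
From HB Require Import structures.
From mathcomp Require Import all_boot all_order all_algebra.

Set Implicit Arguments.
Unset Strict Implicit.
Unset Printing Implicit Defensive.

Import GRing.Theory.
Local Open Scope ring_scope.

(* Directions are 0, 1, 2, 3 : 'I_4, the fourth one being [ord_max]; the
   first three are indexed by i : 'I_3 and embedded by [dir3]. *)
Definition dir3 (i : 'I_3) : 'I_4 := lift ord_max i.

Inductive boundary := Periodic | ZeroInput.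

Section Hypercube.

Variables (F : fieldType) (n : nat).

Definition vertex := {ffun 'I_4 -> 'I_(2 ^ n)}.

(* A line parallel to the i-th axis and meeting the cube is given by the three
   other coordinates of its points, listed in increasing order of axes. *)
Definition line := {ffun 'I_3 -> 'I_(2 ^ n)}.

Definition line_through (i : 'I_4) (x : vertex) : line :=
  [ffun j => x (lift i j)].

(* The vertices cut such a line into 2 ^ n + 1 edges, numbered along its
   direction: edge k enters the vertex with i-th coordinate k and edge k + 1
   leaves it.  Edge 0 belongs to the input and edge 2 ^ n to the output. *)
Definition configuration := 'I_4 -> line -> 'I_(2 ^ n).+1 -> F.

(* [lift ord_max k] has value k and [lift ord0 k] has value k + 1. *)
Definition spins_in (s : configuration) (x : vertex) : 'rV[F]_4 :=
  \row_i s i (line_through i x) (lift ord_max (x i)).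

Definition spins_out (s : configuration) (x : vertex) : 'rV[F]_4 :=
  \row_i s i (line_through i x) (lift ord0 (x i)).

Definition permitted (B : 'M[F]_4) (s : configuration) : Prop :=
  forall x : vertex, spins_out s x = spins_in s x *m B.

Definition boundary_holds (bc : boundary) (s : configuration) : Prop :=
  match bc with
  | Periodic => forall l : line, s ord_max l ord_max = s ord_max l ord0
  | ZeroInput => forall l : line, s ord_max l ord0 = 0
  end.

(* Each of the three thick spaces is a copy of [thick]; an element of
   [thick3] is a triple of elements, one for each of the first three directions. *)
Definition thick := {ffun line -> F^o}.

Definition thick3 := {ffun 'I_3 -> thick}.

Definition input (s : configuration) : thick3 :=
  [ffun i => [ffun l => s (dir3 i) l ord0]].

Definition output (s : configuration) : thick3 :=
  [ffun i => [ffun l => s (dir3 i) l ord_max]].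

(* R is determined by its graph.  As an operator it is written on the left,
   although it stands for right multiplication of row vectors. *)
Definition hypercube_operator (B : 'M[F]_4) (bc : boundary)
    (R : 'End(thick3)) : Prop :=
  forall u v : thick3,
    R u = v <->
    exists s : configuration,
      [/\ permitted B s, boundary_holds bc s, input s = u & output s = v].

Definition embed (i : 'I_3) (v : thick) : thick3 :=
  [ffun j => if j == i then v else 0].

Definition stratification (R : 'End(thick3))
    (W : 'I_3 -> 'I_(2 ^ n) -> {vspace thick}) : Prop :=
  [/\ forall i, (\sum_k W i k)%VS = fullv,
      forall i, directv (\sum_k W i k)%VS,
      forall i k, \dim (W i k) = (4 ^ n)%N
    & forall k (u : thick3),
        (forall i, u i \in W i k) -> forall i, R u i \in W i k].

(* The restriction of R to the sum of the three spaces L i is, up to a change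
   of basis in each of them, the direct sum of the matrices M m. *)
Definition layer_is_direct_sum (R : 'End(thick3))
    (L : 'I_3 -> {vspace thick}) (d : nat) (M : 'I_d -> 'M[F]_3) : Prop :=
  exists v : 'I_3 -> d.-tuple thick,
    (forall i, basis_of (L i) (v i)) /\
    forall i m,
      R (embed i (tnth (v i) m)) = \sum_j M m i j *: embed j (tnth (v j) m).

(* The 3 x 3 matrix of a brick after its fourth edge has been closed up
   (periodic case) or fed with zero and cut off (zero input). *)
Definition effective_brick (B : 'M[F]_4) (bc : boundary) : 'M[F]_3 :=
  \matrix_(i, j)
    match bc with
    | Periodic =>
        B (dir3 i) (dir3 j) + B (dir3 i) ord_max * B ord_max (dir3 j)
    | ZeroInput => B (dir3 i) (dir3 j)
    end.

Definition brick_nondegenerate (B : 'M[F]_4) (bc : boundary) : Prop :=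
  match bc with
  | Periodic =>
      (B 0 1 + B 0 3 * B 3 1) * (B 1 2 + B 1 3 * B 3 2)
        * (B 2 0 + B 2 3 * B 3 0)
      <> (B 0 2 + B 0 3 * B 3 2) * (B 2 1 + B 2 3 * B 3 1)
        * (B 1 0 + B 1 3 * B 3 0)
  | ZeroInput => B 0 2 * B 1 0 * B 2 1 <> B 0 1 * B 1 2 * B 2 0
  end.

Definition tildeB (B : 'M[F]_4) (bc : boundary) : 'M[F]_3 :=
  map_mx (fun b => b ^+ (2 ^ n)) (effective_brick B bc).

End Hypercube.

Arguments tildeB [F] n B bc.

(* Main.v *)
Require Import Defs.
From HB Require Import structures.
From mathcomp Require Import all_boot all_order all_algebra.
From mathcomp Require Import ring zify.

Set Implicit Arguments.
Unset Strict Implicit.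
Unset Printing Implicit Defensive.

Import GRing.Theory.
Local Open Scope ring_scope.

(** In a row of [2 ^ n] bricks along the fourth axis, the bricks interact only
    through the shift [X] of the fourth coordinate.  Since [b44 = 0], a spin
    travelling along that axis goes forward by one step between being emitted
    and being absorbed, so the row is a single three-dimensional brick with the
    entries [b_ij + b_i4 b_4j X], acting on [2 ^ n] spins per edge.  The
    boundary condition makes [X ^ 2 ^ n] equal to a constant [c]: [c = 1] when
    the fourth axis is periodic, [c = 0] when its input vanishes.  The
    hypercube is thus a cube of [3 x 3] bricks [M] over the commutative ring
    [F[X] / (X ^ 2 ^ n - c)] of characteristic 2 ([unfold_fibre_permitted]).

    Over every commutative ring of characteristic 2, a [2 x 2 x 2] cube of
    bricks [M] has four families of triples of vectors, one vector for each
    thick space, on which it acts as a [3 x 3] matrix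
    ([pair_mode_transfers]): for three of the families this is [M] with its
    entries squared, for the fourth the transpose of that.  The vectors are
    tensor products: each axis carries two vectors [turn M] and [turn M^T] of
    length 2, whose determinant is the [circulation]
    [M01 M12 M20 - M02 M21 M10], and each family picks one of them for every
    axis of every face.  Blocks of bricks can be handled as single bricks
    ([renormalize], [transfers_comp]), so iterating [n] times gives [4 ^ n]
    families, indexed by words of length [n] in the four choices
    ([mode_transfers]).  On each of them the cube of side [2 ^ n] acts as the
    entrywise power [M ^ (2 ^ n)], transposed when the transposing choice occurs
    an odd number of times.  The numbers [a], [b] of words of even and odd
    parity obey [a' = 3 a + b], [b' = a + 3 b], whence the two multiplicities
    ([size_words]).

    The power [2 ^ n] is a power of the Frobenius, so it turns
    [b_ij + b_i4 b_4j X] into the scalar [b_ij ^ 2 ^ n + (b_i4 b_4j) ^ 2 ^ n c]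
    of [F].  Therefore the operator acts on the multiples by [X ^ k] of the
    families above in the same way for each [k], and these are the [2 ^ n]
    layers ([operator_mode_vector]).

    All these vectors together span the thick spaces ([thick_spanned]): over
    [F[X]] they span every vector multiplied by a power of the circulation of
    [M] ([mode_span]), and the hypothesis on [B] says that this circulation is
    nonzero at the only root [c] of [X ^ 2 ^ n - c = (X - c) ^ 2 ^ n], hence
    invertible modulo this polynomial.  There are as many of them as the
    dimension, so they are bases and the layers are in direct sum
    ([minimal_spanning_layers]).  The operator itself exists because an input
    of the three-dimensional cube can be propagated brick by brick, and is
    determined by induction along the first three coordinates
    ([zero_input]). *)

(** * Indices modulo 3 *)

Lemma ord3_ind (P : 'I_3 -> Prop) : P 0 -> P 1 -> P 2 -> forall i, P i.
Proof.
move=> h0 h1 h2 [[|[|[|//]]] lti].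
- by rewrite (_ : Ordinal _ = 0) //; apply/val_inj.
- by rewrite (_ : Ordinal _ = 1) //; apply/val_inj.
- by rewrite (_ : Ordinal _ = 2) //; apply/val_inj.
Qed.

(** The three directions play the same role up to a cyclic shift; naming them
    relatively to one of them, as [i], [i + 1], [i + 2], lets one computation
    serve for all three. *)
Lemma ord3_cycle_ind (i : 'I_3) (P : 'I_3 -> Prop) :
  P i -> P (i + 1) -> P (i + 2) -> forall j, P j.
Proof.
move=> h0 h1 h2 j; have: [|| j == i, j == i + 1 | j == i + 2].
  by elim/ord3_ind: i {h0 h1 h2}; elim/ord3_ind: j.
by case/or3P => /eqP ->.
Qed.

Lemma ord3_sum (V : nmodType) (i : 'I_3) (f : 'I_3 -> V) :
  \sum_j f j = f i + f (i + 1) + f (i + 2).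
Proof.
have sumE : \sum_j f j = f 0 + f 1 + f 2.
  rewrite !big_ord_recl big_ord0 addr0 addrA.
  by congr (f _ + f _ + f _); apply/val_inj.
elim/ord3_ind: i; rewrite sumE -!addrA.
- by congr (f _ + (f _ + f _)); apply/val_inj.
- rewrite [RHS]addrA [RHS]addrC.
  by congr (f _ + (f _ + f _)); apply/val_inj.
rewrite addrA addrC.
by congr (f _ + (f _ + f _)); apply/val_inj.
Qed.

Lemma ord3_cycleE (i : 'I_3) :
  ((i + 1 + 1 = i + 2)%R * (i + 1 + 2 = i)%R * (i + 2 + 1 = i)%R
   * (i + 2 + 2 = i + 1)%R)%type.
Proof. by elim/ord3_ind: i; repeat split; apply: val_inj. Qed.

Lemma ord3_cycle_eqE (i : 'I_3) :
  ((i == i + 1 = false)%R * (i == i + 2 = false)%R * (i + 1 == i = false)%R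
   * (i + 2 == i = false)%R * (i + 1 == i + 2 = false)%R
   * (i + 2 == i + 1 = false)%R)%type.
Proof. by elim/ord3_ind: i. Qed.

(** * Spins in an infinite octant *)

Definition site := {ffun 'I_3 -> nat}.

Definition step (i : 'I_3) : site := [ffun j => (j == i) : nat].

Definition step_back (i : 'I_3) (x : site) : site :=
  [ffun j => (x j - (j == i))%N].

(** The site at position [y] in the block number [X] of side [P]. *)
Definition block_site P (X y : site) : site := [ffun j => (X j * P + y j)%N].

Lemma site_addE (x y : site) i : (x + y) i = (x i + y i)%N.
Proof. by rewrite ffunE. Qed.

Lemma step_addK x i : step_back i (x + step i) = x.
Proof. by apply/ffunP => j; rewrite !ffunE addnK. Qed.

Lemma step_backK (x : site) i : (0 < x i)%N -> step_back i x + step i = x.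
Proof.
move=> xi_gt0; apply/ffunP => j; rewrite site_addE !ffunE subnK //.
by case: eqP => [->|].
Qed.

Lemma sum_add_step x i : (\sum_j (x + step i)%R j = (\sum_j x j).+1)%N.
Proof.
under eq_bigr do rewrite site_addE.
rewrite big_split /= -[RHS]addn1; congr (_ + _)%N.
rewrite (bigD1 i) //= big1 ?ffunE ?eqxx // => j /negPf ji.
by rewrite ffunE ji.
Qed.

Lemma block_site_step P X y i :
  block_site P X (y + step i) = block_site P X y + step i.
Proof.
by apply/ffunP => j; rewrite site_addE ffunE site_addE [in RHS]ffunE addnA.
Qed.

(** The face orthogonal to [i] of a cube of side [P] : the coordinate [i] is
    left free, so that the same condition serves for inputs and outputs. *)
Definition face_below P i (x : site) := forall j, j != i -> (x j < P)%N.

Definition face_dependent T (g : 'I_3 -> site -> T) :=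
  forall i (x y : site), (forall j, j != i -> x j = y j) -> g i x = g i y.

Section Octant.

Variables (A : comNzRingType).
Implicit Types (M : 'M[A]_3) (s : site -> 'rV[A]_3) (g : 'I_3 -> site -> A).

(** [s x] is the row of spins on the three edges that enter [x].  On the whole
    octant the configurations need no bound on the coordinates, and a cube
    of any size is seen by looking at a part of one of them. *)
Definition octant M s := forall x i, s (x + step i) 0 i = (s x *m M) 0 i.

(** Tracing spins back by one brick lowers the sum of the coordinates by one,
    and this sum is the fuel [m]. *)
Fixpoint evolve_for M g m (x : site) : 'rV[A]_3 :=
  \row_i if x i == 0%N then g i x
         else if m is m'.+1 then (evolve_for M g m' (step_back i x) *m M) 0 i
         else 0.

Definition evolve M g (x : site) := evolve_for M g (\sum_i x i) x.

Lemma octant_evolve M g : octant M (evolve M g).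
Proof.
move=> x i; rewrite {1}/evolve sum_add_step /= mxE site_addE ffunE eqxx addn1.
by rewrite /= step_addK.
Qed.

Lemma evolve_input M g i (x : site) : x i = 0%N -> evolve M g x 0 i = g i x.
Proof.
by rewrite /evolve => xi; case: (\sum_i _)%N => [|m] /=; rewrite mxE xi.
Qed.

(** A cube of side [P] maps the input [c_i g_i] to the output [(c M')_i g_i]: in
    terms of the coefficients [c] it works as one brick [M']. *)
Definition transfers P M g M' :=
  forall s (c : 'rV[A]_3), octant M s ->
    (forall i (x : site), x i = 0%N -> face_below P i x ->
       s x 0 i = c 0 i * g i x) ->
  forall i (x : site), x i = P -> face_below P i x ->
    s x 0 i = (c *m M') 0 i * g i x.

(** Coarse graining: if the cubes of side [P] map the vectors [g] as a brick
    [M'] does, then a configuration whose inputs are made of copies of [g]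
    with coefficients read off a configuration [t] of bricks [M'] is given by
    [t] at all boundaries of blocks.  This follows the blocks in the order of
    the sum of their coordinates; [Q] bounds the region where the inputs are
    known. *)
Lemma renormalize P Q M g M' s t :
    transfers P M g M' -> face_dependent g -> octant M s -> octant M' t ->
    (forall i (X y : site), X i = 0%N -> face_below Q i X -> y i = 0%N ->
       face_below P i y -> s (block_site P X y) 0 i = t X 0 i * g i y) ->
  forall i (X y : site), (X i <= Q)%N -> face_below Q i X -> y i = 0%N ->
    face_below P i y -> s (block_site P X y) 0 i = t X 0 i * g i y.
Proof.
move=> tr_g dep_g so ts st i X.
have [m] := ubnP (\sum_j X j)%N; elim: m i X => // m IHm i X.
have [Xi0 _ y _ | Xi_gt0] := posnP (X i); first exact: st.
rewrite -[in X in (X <= _)%N](step_backK Xi_gt0) sum_add_step ltnS.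
move=> ltXm y XiQ XQ yi yP.
set X' := step_back i X in ltXm.
have X'lt j : (X' j < Q)%N.
  rewrite ffunE; case: eqP => [->|/eqP/XQ]; last by rewrite subn0.
  by rewrite subn1 prednK.
pose s' y := s (block_site P X' y).
have s'o : octant M s' by move=> z j; rewrite /s' block_site_step so.
(* A spin entering block [X] in direction [i] leaves block [X'] at [y']. *)
pose y' : site := [ffun j => if j == i then P else y j].
have y'P : face_below P i y' by move=> j ji; rewrite ffunE (negPf ji) yP.
have ->: block_site P X y = block_site P X' y'.
  apply/ffunP => j; rewrite !ffunE; case: eqP => [->|]; last by rewrite subn0.
  by rewrite yi addn0 subn1 -mulSnr prednK.
have -> : g i y = g i y' by apply: dep_g => j /negPf ji; rewrite ffunE ji.
rewrite -[X in t X](step_backK Xi_gt0) ts.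
apply: tr_g s'o _ _ _ _ y'P; last by rewrite ffunE eqxx.
by move=> j z zj zP; apply: IHm => //; apply: ltnW.
Qed.

Definition compose_modes P g g' : 'I_3 -> site -> A :=
  fun i x => g' i [ffun j => (x j %/ P)%N] * g i [ffun j => (x j %% P)%N].

Lemma face_dependent_comp P g g' :
  face_dependent g -> face_dependent g' ->
  face_dependent (compose_modes P g g').
Proof.
move=> dg dg' i x y xy; rewrite /compose_modes.
by congr (_ * _); [apply: dg' | apply: dg] => j ji; rewrite !ffunE xy.
Qed.

Lemma transfers_comp P Q M g M' g' M'' : (0 < P)%N ->
    face_dependent g ->
    transfers P M g M' -> transfers Q M' g' M'' ->
  transfers (P * Q) M (compose_modes P g g') M''.
Proof.
move=> P_gt0 dg tr_g tr_g' s c so si i x xi xPQ.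
pose inp i (X : site) := c 0 i * g' i X.
have to := octant_evolve M' inp; have ti := @evolve_input M' inp.
move: (evolve _ _) to ti => t to ti.
have xE : x = block_site P [ffun j => (x j %/ P)%N] [ffun j => (x j %% P)%N].
  by apply/ffunP => j; rewrite !ffunE -divn_eq.
rewrite [in LHS]xE (renormalize (Q := Q) tr_g dg so to).
- rewrite mulrA (tr_g' _ c) ?mulrA //.
  + by move=> j X Xj _; rewrite ti.
  + by rewrite ffunE xi mulKn.
  by move=> j ji; rewrite ffunE ltn_divLR // mulnC xPQ.
- move=> j X y Xj XQ yj yP; rewrite ti // si; last first.
  + move=> k kj; rewrite ffunE; have := XQ k kj; have := yP k kj.
    by nia.
  + by rewrite ffunE Xj yj.
  have yltP k : (y k < P)%N by have [->|/yP] := eqVneq k j; rewrite ?yj.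
  rewrite /inp /compose_modes mulrA; congr (_ * g' j _ * g j _);
    apply/ffunP => k; rewrite !ffunE.
    by rewrite divnMDl // divn_small ?addn0.
  by rewrite modnMDl modn_small.
- by rewrite ffunE xi mulKn.
- by move=> j ji; rewrite ffunE ltn_divLR // mulnC xPQ.
- by rewrite ffunE xi modnMr.
by move=> j ji; rewrite ffunE ltn_mod.
Qed.

End Octant.

(** * The cube of side two in characteristic 2 *)

Section PairModes.

Variables (A : comNzRingType).
Hypothesis A2 : 2%N \in [pchar A].
Implicit Types (M : 'M[A]_3) (q : option 'I_3).

(** A vector of length 2 along the axis [j].  Its first entry is the amplitude
    for turning from direction [j + 1] to [j + 2] at one brick, its second one
    is a permanent of order 2, that is to say a minor in characteristic 2. *)
Definition turn M (j : 'I_3) (k : nat) : A :=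
  if k is 0 then M (j + 1) (j + 2)
  else M (j + 1) (j + 2) * M j j + M (j + 1) j * M j (j + 2).

(** The tensor products on which the cube of side 2 acts as a brick: [None] is
    the family where the transpose appears.  As [c] runs over the three
    directions, [Some c] gives to each thick space the three other pairs of
    factors on its two axes, so that the four families exhaust the tensor
    products. *)
Definition pair_mode M q (i : 'I_3) (x : site) : A :=
  if q is Some c then
    turn (if c == i then M else M^T) (i + 1) (x (i + 1))
    * turn (if c == i + 2 then M^T else M) (i + 2) (x (i + 2))
  else turn M (i + 1) (x (i + 1)) * turn M^T (i + 2) (x (i + 2)).

Definition refine q M : 'M[A]_3 :=
  map_mx (fun b => b ^+ 2) (if q is Some _ then M else M^T).

Definition site_around (i : 'I_3) a b c : site :=
  [ffun j => if j == i then a else if j == i + 1 then b else c].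

Lemma site_aroundE i (x : site) :
  x = site_around i (x i) (x (i + 1)) (x (i + 2)).
Proof.
apply/ffunP; elim/(ord3_cycle_ind (i := i));
  by rewrite ffunE ?eqxx ?ord3_cycle_eqE.
Qed.

Lemma site_around_step i a b c :
  (site_around i a b c + step i = site_around i a.+1 b c)
  * (site_around i a b c + step (i + 1) = site_around i a b.+1 c)
  * (site_around i a b c + step (i + 2) = site_around i a b c.+1).
Proof.
split; [split|]; apply/ffunP; elim/(ord3_cycle_ind (i := i));
  by rewrite site_addE !ffunE ?eqxx ?ord3_cycle_eqE (addn0, addn1).
Qed.

Lemma forall_lt2 (Q : nat -> Prop) :
  Q 0%N -> Q 1%N -> forall a, (a < 2)%N -> Q a.
Proof. by move=> q0 q1 [|[|]]. Qed.

Lemma char2_even k : k.*2%:R = 0 :> A.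
Proof. by rewrite -mul2n natrM (pcharf0 A2) mul0r. Qed.

Lemma char2_odd k : k.*2.+1%:R = 1 :> A.
Proof. by rewrite -add1n natrD char2_even addr0. Qed.

(** The heart of the proof, a polynomial identity modulo 2 in the entries of
    [M]: the contributions of different paths through the cube that are not
    wanted come in equal pairs. *)
Lemma pair_mode_transfers M q : transfers 2 M (pair_mode M q) (refine q M).
Proof.
(* [ring] does not reduce coefficients modulo 2; these are the ones that occur
   in the expansions. *)
have H2 : 2 = 0 :> A := char2_even 1; have H3 : 3 = 1 :> A := char2_odd 1.
have H4 : 4 = 0 :> A := char2_even 2; have H6 : 6 = 0 :> A := char2_even 3.
move=> s c so si i x xi xlt; rewrite (site_aroundE i x) xi.
have E0 a b d : s (site_around i a.+1 b d) 0 i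
    = s (site_around i a b d) 0 i * M i i
      + s (site_around i a b d) 0 (i + 1) * M (i + 1) i
      + s (site_around i a b d) 0 (i + 2) * M (i + 2) i.
  by rewrite -!site_around_step so mxE (ord3_sum i).
have E1 a b d : s (site_around i a b.+1 d) 0 (i + 1)
    = s (site_around i a b d) 0 i * M i (i + 1)
      + s (site_around i a b d) 0 (i + 1) * M (i + 1) (i + 1)
      + s (site_around i a b d) 0 (i + 2) * M (i + 2) (i + 1).
  by rewrite -!site_around_step so mxE (ord3_sum i).
have E2 a b d : s (site_around i a b d.+1) 0 (i + 2)
    = s (site_around i a b d) 0 i * M i (i + 2)
      + s (site_around i a b d) 0 (i + 1) * M (i + 1) (i + 2)
      + s (site_around i a b d) 0 (i + 2) * M (i + 2) (i + 2).
  by rewrite -!site_around_step so mxE (ord3_sum i).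
have I0 b d : (b < 2)%N -> (d < 2)%N -> s (site_around i 0 b d) 0 i
    = c 0 i * pair_mode M q i (site_around i 0 b d).
  move=> lb ld; apply: si; first by rewrite ffunE eqxx.
  by elim/(ord3_cycle_ind (i := i)); rewrite ?ffunE ?eqxx ?ord3_cycle_eqE.
have I1 a d : (a < 2)%N -> (d < 2)%N -> s (site_around i a 0 d) 0 (i + 1)
    = c 0 (i + 1) * pair_mode M q (i + 1) (site_around i a 0 d).
  move=> lb ld; apply: si; first by rewrite ffunE ord3_cycle_eqE eqxx.
  by elim/(ord3_cycle_ind (i := i)); rewrite ?ffunE ?eqxx ?ord3_cycle_eqE.
have I2 a b : (a < 2)%N -> (b < 2)%N -> s (site_around i a b 0) 0 (i + 2)
    = c 0 (i + 2) * pair_mode M q (i + 2) (site_around i a b 0).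
  move=> lb ld; apply: si; first by rewrite ffunE !ord3_cycle_eqE.
  by elim/(ord3_cycle_ind (i := i)); rewrite ?ffunE ?eqxx ?ord3_cycle_eqE.
have := xlt (i + 2); have := xlt (i + 1); rewrite !ord3_cycle_eqE {xlt xi}.
move: {x}(x (i + 1)) (x (i + 2)) => b d /(_ isT) ltb /(_ isT) ltd.
move: b ltb d ltd; apply: forall_lt2; apply: forall_lt2;
  rewrite !(E0, E1, E2) !(I0, I1, I2) // {E0 E1 E2 I0 I1 I2};
  rewrite mxE (ord3_sum i) !mxE /=;
  rewrite /pair_mode /= !ffunE !ord3_cycleE ?eqxx ?ord3_cycle_eqE;
  (case: q {si} => [q|]; [elim/(ord3_cycle_ind (i := i)): q | ]);
  rewrite /turn /= ?ord3_cycleE ?eqxx ?ord3_cycle_eqE ?mxE.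
all: ring: H2 H3 H4 H6.
Qed.

End PairModes.

(** * Words, and the modes that they index *)

Definition word := seq (option 'I_3).

(** The words of length [n] whose number of letters [None] has the parity
    [b]. *)
Fixpoint words (b : bool) n : seq word :=
  if n is n'.+1 then
    [seq Some q :: w | q <- enum 'I_3, w <- words b n']
    ++ [seq None :: w | w <- words (~~ b) n']
  else if b then [::] else [:: [::]].

Lemma mem_words b n w :
  w \in words b n -> size w = n /\ odd (count_mem None w) = b.
Proof.
elim: n b w => [|n IHn] b w /=.
  by case: b; rewrite // inE => /eqP ->.
rewrite mem_cat => /orP[/allpairsP[[q v] /= [_ vw ->]]|/mapP[v vw ->]] /=.
  by have [-> ->] := IHn _ _ vw.
by have [-> /= ->] := IHn _ _ vw; rewrite negbK.
Qed.

Lemma size_words n :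
  (size (words false n.+1) = 2 ^ (2 * n.+1 - 1) + 2 ^ n
   /\ size (words true n.+1) = 2 ^ (2 * n.+1 - 1) - 2 ^ n)%N.
Proof.
have szS b m :
    (size (words b m.+1) = 3 * size (words b m) + size (words (~~ b) m))%N.
  by rewrite /= size_cat size_allpairs size_enum_ord size_map.
elim: n => [|n [IH0 IH1]]; first by rewrite !szS.
rewrite !(szS _ n.+1) IH0 IH1.
have -> : (2 * n.+2 - 1 = (2 * n.+1 - 1).+2)%N by lia.
have : (2 ^ n <= 2 ^ (2 * n.+1 - 1))%N by rewrite leq_exp2l //; lia.
by rewrite !expnS; lia.
Qed.

Lemma sum_option (V : nmodType) (T : finType) (F : option T -> V) :
  \sum_q F q = F None + \sum_q F (Some q).
Proof.
rewrite (bigD1 None) //= (reindex_omap Some id) /=; last by case.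
by congr (_ + _); apply: eq_bigl => q; rewrite eqxx.
Qed.

Lemma sum_words_recl (V : nmodType) n (F : word -> V) :
  \sum_b \sum_(w <- words b n.+1) F w
  = \sum_q \sum_b \sum_(w <- words b n) F (q :: w).
Proof.
have sumS b : \sum_(w <- words b n.+1) F w
    = \sum_q \sum_(w <- words b n) F (Some q :: w)
      + \sum_(w <- words (~~ b) n) F (None :: w).
  rewrite /= big_cat big_allpairs_dep.
  by congr (_ + _); rewrite (big_map, big_enum).
under eq_bigr do rewrite sumS.
rewrite big_split sum_option exchange_big addrC; congr (_ + _).
by rewrite !big_bool /= addrC.
Qed.

Section Modes.

Variables (A : comNzRingType).
Hypothesis A2 : 2%N \in [pchar A].
Implicit Types (M : 'M[A]_3) (q : option 'I_3) (w : word).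

Fixpoint mode w M : 'I_3 -> site -> A :=
  if w is q :: w' then compose_modes 2 (pair_mode M q) (mode w' (refine q M))
  else fun _ _ => 1.

Definition frobenius_brick n (b : bool) M : 'M[A]_3 :=
  map_mx (fun x => x ^+ (2 ^ n)) (if b then M^T else M).

Lemma face_dependent_pair M q : face_dependent (pair_mode M q).
Proof.
by move=> i x y xy; rewrite /pair_mode !xy ?ord3_cycle_eqE.
Qed.

Lemma face_dependent_mode w M : face_dependent (mode w M).
Proof.
elim: w M => [|q w IHw] M //=.
exact: face_dependent_comp (face_dependent_pair _ _) (IHw _).
Qed.

Lemma frobenius_brick_refine n b q M :
  frobenius_brick n b (refine q M)
  = frobenius_brick n.+1 (b (+) (q == None)) M.
Proof.
rewrite /frobenius_brick /refine; apply/matrixP => i j.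
by case: q; case: b; rewrite /= !mxE -exprM expnS.
Qed.

(** Each letter doubles the side of the cube, the first one forming the smallest
    blocks. *)
Lemma mode_transfers w M :
  transfers (2 ^ size w) M (mode w M)
    (frobenius_brick (size w) (odd (count_mem None w)) M).
Proof.
elim: w M => [|q w IHw] M /=.
  move=> s c so si i x xi x1.
  have -> : x = [ffun j => (j == i) : nat].
    apply/ffunP => j; rewrite ffunE; case: eqVneq => [->//|/x1].
    by case: (x j).
  pose y : site := [ffun j => 0%N].
  have -> : [ffun j => (j == i) : nat] = y + step i.
    by apply/ffunP => j; rewrite site_addE !ffunE.
  rewrite so mulr1; congr (_ 0 i); congr (_ *m _); last first.
    by apply/matrixP => k l; rewrite mxE.
  by apply/rowP => j; rewrite si ?mulr1 ?ffunE // => k _; rewrite ffunE.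
rewrite expnS oddD addbC oddb -frobenius_brick_refine.
apply: (transfers_comp _ (face_dependent_pair _ _)) (IHw _) => //.
exact: pair_mode_transfers.
Qed.

(** In characteristic 2, the determinant of [turn M j] and [turn M^T j] on every
    axis [j]. *)
Definition circulation M : A :=
  M 0 1 * M 1 2 * M 2 0 - M 0 2 * M 2 1 * M 1 0.

Lemma addr2 (a : A) : a + a = 0.
Proof. by rewrite -mulr2n -mulr_natr (pcharf0 A2) mulr0. Qed.

Lemma circulationE M i :
  circulation M = M i (i + 1) * M (i + 1) (i + 2) * M (i + 2) i
                  + M (i + 1) i * M (i + 2) (i + 1) * M i (i + 2).
Proof.
have eqN (a : A) : - a = a by apply/eqP; rewrite -subr_eq0 -opprD addr2 oppr0.
have ord_rel : (0 + 1 = 1 :> 'I_3)%R * (0 + 2 = 2 :> 'I_3)%R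
  * (1 + 1 = 2 :> 'I_3)%R * (1 + 2 = 0 :> 'I_3)%R
  * (2 + 1 = 0 :> 'I_3)%R * (2 + 2 = 1 :> 'I_3)%R.
  by repeat split; apply: val_inj.
by rewrite /circulation eqN; elim/ord3_ind: i; rewrite !ord_rel; ring.
Qed.

Lemma circulation_refine q M : circulation (refine q M) = circulation M ^+ 2.
Proof.
have H2 : 2 = 0 :> A := char2_even A2 1.
by case: q => [q|]; rewrite !(circulationE _ 0) !mxE; ring: H2.
Qed.

(** Cramer's rule for the two vectors [turn M j] and [turn M^T j]. *)
Lemma turn_basis M j (a k : nat) : (a < 2)%N -> (k < 2)%N ->
  turn M^T j (1 - a) * turn M j k + turn M j (1 - a) * turn M^T j k
  = circulation M * (k == a)%:R.
Proof.
have H2 : 2 = 0 :> A := char2_even A2 1.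
move=> a2 k2; rewrite (circulationE _ j).
by move: a a2 k k2; apply: forall_lt2; apply: forall_lt2;
  rewrite /turn /= ?mxE; ring: H2.
Qed.

Lemma sum_option_ord3 (V : nmodType) i (F : option 'I_3 -> V) :
  \sum_q F q = F None + (F (Some i) + F (Some (i + 1)) + F (Some (i + 2))).
Proof. by rewrite sum_option (ord3_sum i). Qed.

(** The coefficients that Cramer's rule gives on the axes [i + 1] and [i + 2],
    multiplied together, for the unit vector at [(a, b)]. *)
Definition pair_dual M q (i : 'I_3) (a b : nat) : A :=
  if q is Some c then
    turn (if c == i then M^T else M) (i + 1) (1 - a)
    * turn (if c == i + 2 then M else M^T) (i + 2) (1 - b)
  else turn M^T (i + 1) (1 - a) * turn M (i + 2) (1 - b).

Lemma pair_mode_basis M i (a b : nat) (x : site) :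
  (a < 2)%N -> (b < 2)%N -> face_below 2 i x ->
  \sum_q pair_dual M q i a b * pair_mode M q i x
  = circulation M ^+ 2 * ((x (i + 1) == a) && (x (i + 2) == b))%:R.
Proof.
move=> a2 b2 x2; rewrite -mulnb natrM expr2 mulrACA.
rewrite -(turn_basis M (i + 1) a2) ?x2 ?ord3_cycle_eqE //.
rewrite -(turn_basis M (i + 2) b2) ?x2 ?ord3_cycle_eqE //.
rewrite (sum_option_ord3 i) /pair_dual /pair_mode !eqxx !ord3_cycle_eqE.
ring.
Qed.

(** Every vector times a power of the circulation is a combination of modes.
    The exponent depends on the size only; it grows with each letter because the
    circulation of a refined brick is the square of the former one. *)
Lemma mode_span n : exists e, forall M i (f : nat -> nat -> A),
  exists c : word -> A, forall x : site, face_below (2 ^ n) i x ->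
    circulation M ^+ e * f (x (i + 1)) (x (i + 2))
    = \sum_b \sum_(w <- words b n) c w * mode w M i x.
Proof.
elim: n => [|n [e IHn]].
  exists 0%N => M i f; exists (fun=> f 0%N 0%N) => x x1.
  rewrite big_bool /= big_nil add0r big_seq1 mul1r mulr1.
  by case: (x (i + 1)) (x1 (i + 1)) (x (i + 2)) (x1 (i + 2)) => [|?] ;
   rewrite !ord3_cycle_eqE => /(_ isT) // _ [|?] /(_ isT).
exists (2 + 2 * e)%N => M i f.
(* [f' q] is the coefficient of [pair_mode M q] in each block of side 2. *)
pose f' q X Y := \sum_(a < 2) \sum_(b < 2)
  f (X * 2 + a)%N (Y * 2 + b)%N * pair_dual M q i a b.
have /fin_all_exists [c cP] q := IHn (refine q M) i (f' q).
exists (fun w => if w is q :: w' then c q w' else 0) => x xn.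
rewrite sum_words_recl.
pose X : site := [ffun j => (x j %/ 2)%N].
pose y : site := [ffun j => (x j %% 2)%N].
have Xn : face_below (2 ^ n) i X.
  by move=> j /xn; rewrite ffunE ltn_divLR // -expnSr.
have y2 : face_below 2 i y by move=> j _; rewrite ffunE ltn_mod.
transitivity (\sum_q circulation M ^+ (2 * e)
    * (f' q (X (i + 1)) (X (i + 2)) * pair_mode M q i y)); last first.
  apply: eq_bigr => q _; rewrite mulrA exprM -(circulation_refine q) cP //.
  rewrite mulr_suml; apply: eq_bigr => b _.
  by rewrite mulr_suml; apply: eq_bigr => w _; rewrite mulrA.
rewrite -big_distrr addnC exprD -mulrA /=; congr (_ * _).
under eq_bigr do rewrite mulr_suml.
rewrite exchange_big /=.
under eq_bigr => a _.
  under eq_bigr do rewrite mulr_suml.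
  rewrite exchange_big /=.
  under eq_bigr => b _.
    under eq_bigr do rewrite -mulrA.
    rewrite -big_distrr /= pair_mode_basis //.
    over.
  over.
rewrite (bigD1 (inord (y (i + 1)))) //= (bigD1 (inord (y (i + 2)))) //=.
rewrite !inordK ?ffunE ?ltn_mod // -!divn_eq !eqxx mulr1.
have neq_bit (k : nat) (a : 'I_2) :
    a != inord (k %% 2) -> ((k %% 2)%N == a) = false.
  by apply: contraNF => /eqP ->; rewrite inord_val.
rewrite !big1 ?addr0; first by rewrite mulrC.
  by move=> a /neq_bit na; rewrite big1 // => b _; rewrite na !mulr0.
by move=> b /neq_bit ->; rewrite andbF !mulr0.
Qed.

End Modes.

(** * Coefficients modulo X ^ N - c *)

Section WrappedCoefficients.

Variables (F : fieldType) (N : nat) (c : F).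
Hypothesis N_gt0 : (0 < N)%N.
Implicit Types p q : {poly F}.

Definition wrap_mod : {poly F} := 'X^N - c%:P.

Definition wrapped k p : F := (p %% wrap_mod)`_k.

Lemma size_wrap_mod : size wrap_mod = N.+1.
Proof. by rewrite size_XnsubC. Qed.

Lemma wrap_mod_neq0 : wrap_mod != 0.
Proof. by rewrite -size_poly_gt0 size_wrap_mod. Qed.

Lemma size_wrap p : (size (p %% wrap_mod)%R <= N)%N.
Proof. by rewrite -ltnS -size_wrap_mod ltn_modp wrap_mod_neq0. Qed.

Lemma wrappedD k p q : wrapped k (p + q) = wrapped k p + wrapped k q.
Proof. by rewrite /wrapped modpD coefD. Qed.

Lemma wrappedZ k a p : wrapped k (a *: p) = a * wrapped k p.
Proof. by rewrite /wrapped modpZl coefZ. Qed.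

Lemma wrapped0 k : wrapped k 0 = 0.
Proof. by rewrite /wrapped mod0p coef0. Qed.

Lemma wrapped_sum k (I : Type) (r : seq I) (P : pred I) (f : I -> {poly F}) :
  wrapped k (\sum_(i <- r | P i) f i) = \sum_(i <- r | P i) wrapped k (f i).
Proof. by rewrite (big_morph _ (wrappedD k) (wrapped0 k)). Qed.

Lemma wrapped_small k p : (size p <= N)%N -> wrapped k p = p`_k.
Proof. by move=> ltpN; rewrite /wrapped modp_small // size_wrap_mod ltnS. Qed.

Lemma wrapped_mul_mod k p q :
  wrapped k ((p %% wrap_mod) * q) = wrapped k (p * q).
Proof. by rewrite /wrapped mulrC modp_mul mulrC. Qed.

Lemma wrapped_mulXn k p : wrapped k ('X^N * p) = c * wrapped k p.
Proof.
by rewrite -[in LHS](subrK c%:P 'X^N) mulrDl wrappedD mul_polyC wrappedZ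
           /wrapped modp_mulr coef0 add0r.
Qed.

(** Multiplication by [X] shifts the coefficients, the last one coming back at
    the start with the factor [c]: this is how a spin moves along the fourth
    axis. *)
Lemma wrapped_mulX k p : (k < N)%N ->
  wrapped k ('X * p) = if k is k'.+1 then wrapped k' p else c * wrapped N.-1 p.
Proof.
move=> ltkN; rewrite [in LHS]mulrC -wrapped_mul_mod.
have rE : p %% wrap_mod
    = take_poly N.-1 (p %% wrap_mod) + wrapped N.-1 p *: 'X^(N.-1).
  apply/polyP => j; rewrite coefD coef_take_poly coefZ coefXn.
  case: (ltngtP j N.-1) => [_|ltNj|->]; rewrite ?mulr0 ?mulr1 ?addr0 ?add0r //.
  by rewrite nth_default // (leq_trans (size_wrap p)) // -(prednK N_gt0).
rewrite {1}rE mulrDl -scalerAl -exprSr prednK // -[('X^N)%R]mulr1.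
have size_take : (size (take_poly N.-1 (p %% wrap_mod) * 'X)%R <= N)%N.
  rewrite (leq_trans (size_polyMleq _ _)) // size_polyX addn2 /=.
  by rewrite -{2}(prednK N_gt0) ltnS size_take_poly.
rewrite wrappedD wrappedZ wrapped_mulXn (wrapped_small _ size_take).
rewrite [wrapped k 1]wrapped_small ?size_poly1 //.
rewrite coefMX coef1; case: k ltkN => [|k] ltkN /=.
  by rewrite add0r mulr1 mulrC.
rewrite coef_take_poly -(ltn_add2r 1) !addn1 prednK // ltkN.
by rewrite !mulr0 addr0.
Qed.

Lemma wrapped_expand k p q :
  wrapped k (p * q) = \sum_(j < N) wrapped j p * wrapped k ('X^j * q).
Proof.
rewrite -wrapped_mul_mod.
have -> : p %% wrap_mod = \sum_(j < N) wrapped j p *: 'X^j.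
  rewrite -(poly_def _ (wrapped^~ p)); apply/polyP => j; rewrite coef_poly.
  by case: ltnP => // leNj; rewrite nth_default // (leq_trans (size_wrap p)).
rewrite mulr_suml wrapped_sum; apply: eq_bigr => j _.
by rewrite -scalerAl wrappedZ.
Qed.

Lemma wrapped_inverse p : coprimep p wrap_mod ->
  exists d, forall k q e, wrapped k (d ^+ e * (p ^+ e * q)) = wrapped k q.
Proof.
move/Bezout_eq1_coprimepP => [[u v] /= uv]; exists u => k q e.
elim: e => [|e IHe]; first by rewrite !expr0 !mul1r.
have -> : u ^+ e.+1 * (p ^+ e.+1 * q)
   = u ^+ e * (p ^+ e * q) - v * (u ^+ e * (p ^+ e * q)) * wrap_mod.
  have up : u * p = 1 - v * wrap_mod by rewrite -uv addrK.
  transitivity (u * p * (u ^+ e * (p ^+ e * q))); first by rewrite !exprS; ring.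
  by rewrite up; ring.
by rewrite wrappedD -mulNr {2}/wrapped modp_mull coef0 addr0.
Qed.

Hypotheses (n : nat) (Nn : N = (2 ^ n)%N) (F2 : 2%N \in [pchar F]).
Hypothesis cN : c ^+ N = c.

Lemma char2_exprD (R : comNzRingType) (x y : R) :
  2%N \in [pchar R] -> (x + y) ^+ N = x ^+ N + y ^+ N.
Proof.
by move=> R2; rewrite exprDn_pchar // Nn pnatX (eq_pnat _ (pcharf_eq R2)).
Qed.

(** In characteristic 2 the power [2 ^ n] of a polynomial of degree 1 is
    affine in [X ^ N], which acts as [c]. *)
Lemma wrapped_Frobenius k a b p :
  wrapped k ((a%:P + b%:P * 'X) ^+ N * p) = (a + b * c) ^+ N * wrapped k p.
Proof.
have P2 : 2%N \in [pchar {poly F}] by rewrite pchar_poly.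
rewrite !char2_exprD // !exprMn cN -!polyC_exp mulrDl wrappedD.
rewrite mul_polyC wrappedZ.
by rewrite -mulrA mul_polyC wrappedZ wrapped_mulXn mulrDl mulrA.
Qed.

Lemma coprimep_wrap p : p.[c] != 0 -> coprimep p wrap_mod.
Proof.
move=> pc; have P2 : 2%N \in [pchar {poly F}] by rewrite pchar_poly.
rewrite (_ : wrap_mod = ('X - c%:P) ^+ N) ?coprimep_expr ?coprimep_XsubC //.
by rewrite /wrap_mod -polyCN char2_exprD // -polyC_exp !(oppr_pchar2 F2) cN.
Qed.

End WrappedCoefficients.

(** * The input determines the output *)

Section Uniqueness.

Variables (F : fieldType) (n : nat) (B : 'M[F]_4) (bc : boundary).
Hypothesis B44 : B ord_max ord_max = 0.
Implicit Types s : configuration F n.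

Definition add_config a s s' : configuration F n :=
  fun d l k => a * s d l k + s' d l k.

Lemma add_permitted a s s' :
  permitted B s -> permitted B s' -> permitted B (add_config a s s').
Proof.
move=> sB s'B x.
have -> : spins_out (add_config a s s') x = a *: spins_out s x + spins_out s' x.
  by apply/rowP => d; rewrite !mxE.
rewrite sB s'B scalemxAl -mulmxDl; congr (_ *m _).
by apply/rowP => d; rewrite !mxE.
Qed.

Lemma add_boundary a s s' : boundary_holds bc s -> boundary_holds bc s' ->
  boundary_holds bc (add_config a s s').
Proof.
by rewrite /boundary_holds; case: bc => bs bs' l;
   rewrite /add_config bs bs' ?mulr0 ?addr0.
Qed.

Lemma input_add a s s' : input (add_config a s s') = a *: input s + input s'.
Proof. by apply/ffunP => i; apply/ffunP => l; rewrite !ffunE. Qed.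

Lemma output_add a s s' :
  output (add_config a s s') = a *: output s + output s'.
Proof. by apply/ffunP => i; apply/ffunP => l; rewrite !ffunE. Qed.

Lemma ord4_ind (P : 'I_4 -> Prop) :
  (forall i, P (dir3 i)) -> P ord_max -> forall d, P d.
Proof. by move=> Pd Pm d; case: (unliftP ord_max d) => [i|] ->. Qed.

Lemma sum_dir (V : nmodType) (f : 'I_4 -> V) :
  \sum_d f d = f ord_max + \sum_i f (dir3 i).
Proof. by rewrite (bigD1_ord ord_max). Qed.

Definition set_coord (x : vertex n) d k : vertex n :=
  [ffun e => if e == d then k else x e].

Lemma line_through_set x d k :
  line_through d (set_coord x d k) = line_through d x.
Proof. by apply/ffunP => j; rewrite !ffunE eq_sym (negPf (neq_lift _ _)). Qed.

Lemma set_coord_id x d : set_coord x d (x d) = x.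
Proof. by apply/ffunP => e; rewrite ffunE; case: eqP => [->|]. Qed.

(** As [b44 = 0], a spin on the fourth axis only depends on the other spins that
    enter the vertex just before it; the boundary condition takes care of the
    first one. *)
Lemma column_zero s (x : vertex n) : permitted B s -> boundary_holds bc s ->
    (forall k i, spins_in s (set_coord x ord_max k) 0 (dir3 i) = 0) ->
  forall k, spins_in s (set_coord x ord_max k) = 0.
Proof.
move=> sB sbc x0.
have out0 k : s ord_max (line_through ord_max x) (lift ord0 k) = 0.
  have := congr1 (fun r : 'rV_4 => r 0 ord_max) (sB (set_coord x ord_max k)).
  rewrite mxE line_through_set ffunE eqxx => ->.
  by rewrite mxE sum_dir B44 mulr0 add0r big1 // => i _; rewrite x0 mul0r.
have in0 k : s ord_max (line_through ord_max x) k = 0.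
  have [k' ->|->] := unliftP ord0 k; first exact: out0.
  case: bc sbc => [periodic|]; last exact.
  rewrite -periodic.
  have lastP : ((2 ^ n).-1 < 2 ^ n)%N by rewrite ltn_predL expn_gt0.
  rewrite (_ : ord_max = lift ord0 (Ordinal lastP)) ?out0 //.
  by apply/val_inj; rewrite /= /bump /= add1n prednK ?expn_gt0.
move=> k; apply/rowP; elim/ord4_ind => [i|]; first by rewrite x0 mxE.
by rewrite !mxE line_through_set in0.
Qed.

(** All spins vanish, by induction on the sum of the first three coordinates:
    [column_zero] treats together all vertices that share them. *)
Lemma zero_input s : permitted B s -> boundary_holds bc s -> input s = 0 ->
  output s = 0.
Proof.
move=> sB sbc s0.
have spins0 m (x : vertex n) : (\sum_i x (dir3 i) < m)%N -> spins_in s x = 0.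
  elim: m x => // m IHm x; rewrite ltnS => xm.
  rewrite -[x](set_coord_id _ ord_max); apply: column_zero => // k i.
  set y := set_coord x ord_max k.
  have ym : (\sum_i y (dir3 i) <= m)%N.
    by under eq_bigr do rewrite ffunE eq_sym (negPf (neq_lift _ _)).
  rewrite mxE; have [y' e|e] := unliftP ord0 (lift ord_max (y (dir3 i))).
    have yi : (y (dir3 i) : nat) = y'.+1.
      by have := congr1 (@nat_of_ord _) e; rewrite lift0 lift_max.
    have := congr1 (fun r : 'rV_4 => r 0 (dir3 i))
                   (sB (set_coord y (dir3 i) y')).
    rewrite mxE line_through_set ffunE eqxx e => ->.
    rewrite IHm ?mul0mx ?mxE // (leq_trans _ ym) //.
    rewrite !(bigD1 (P := predT) i) //= ffunE eqxx yi addSn ltnS leq_add2l.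
    apply: leq_sum => j ji; rewrite ffunE (inj_eq lift_inj) (negPf ji) //.
  rewrite e; have /ffunP/(_ i) := s0.
  by move=> /ffunP/(_ (line_through (dir3 i) y)); rewrite !ffunE.
apply/ffunP => i; apply/ffunP => l; rewrite !ffunE.
have lastP : ((2 ^ n).-1 < 2 ^ n)%N by rewrite ltn_predL expn_gt0.
pose x : vertex n :=
  [ffun d => if unlift (dir3 i) d is Some j then l j else Ordinal lastP].
have lx : line_through (dir3 i) x = l.
  by apply/ffunP => j; rewrite !ffunE liftK.
have := congr1 (fun r : 'rV_4 => r 0 (dir3 i)) (sB x).
rewrite (spins0 (\sum_i x (dir3 i)).+1) // mul0mx !mxE lx => <-.
congr (s _ _ _).
by apply/val_inj; rewrite ffunE unlift_none /= /bump /= add1n prednK ?expn_gt0.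
Qed.

Lemma output_unique s s' : permitted B s -> boundary_holds bc s ->
    permitted B s' -> boundary_holds bc s' -> input s = input s' ->
  output s = output s'.
Proof.
move=> sB sbc s'B s'bc ss'; apply/eqP; rewrite -subr_eq0 addrC -scaleN1r.
rewrite -output_add; apply/eqP/zero_input; first exact: add_permitted.
  exact: add_boundary.
by rewrite input_add ss' scaleN1r addNr.
Qed.

End Uniqueness.

(** * From cubes over F[X] to hypercubes over F *)

Section Unfolding.

Variables (F : fieldType) (n : nat) (B : 'M[F]_4) (bc : boundary).
Hypothesis B44 : B ord_max ord_max = 0.
Implicit Types (sigma : site -> 'rV[{poly F}]_3).

(** The spin leaving the fourth axis enters it again multiplied by this
    constant. *)
Definition feedback : F := if bc is Periodic then 1 else 0.

Local Notation coef := (wrapped (2 ^ n) feedback).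

Let N_gt0 : (0 < 2 ^ n)%N. Proof. by rewrite expn_gt0. Qed.

(** The row of bricks along the fourth axis as one brick over [F[X]]: a path
    through the fourth axis turns into it and out of it again one step
    further. *)
Definition fibre_brick : 'M[{poly F}]_3 :=
  \matrix_(i, j) ((B (dir3 i) (dir3 j))%:P
                  + (B (dir3 i) ord_max * B ord_max (dir3 j))%:P * 'X).

Definition vertex_site (x : vertex n) : site := [ffun j => x (dir3 j) : nat].

(** The position [k] on the line [l] of direction [i], with the fourth
    coordinate dropped. *)
Definition line_site i (l : line n) (k : nat) : site :=
  [ffun j => if unlift (dir3 i) (dir3 j) is Some j' then l j' : nat else k].

Lemma line_site_below i l k : face_below (2 ^ n) i (line_site i l k).
Proof.
move=> j ji; rewrite ffunE.
have ij : dir3 i != dir3 j by rewrite (inj_eq lift_inj) eq_sym.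
by have [j' _ ->] := unlift_some ij.
Qed.

Lemma line_site_at i l k : line_site i l k i = k.
Proof. by rewrite ffunE unlift_none. Qed.

Lemma line_through_site i (x : vertex n) :
  line_site i (line_through (dir3 i) x) (x (dir3 i)) = vertex_site x.
Proof.
apply/ffunP => j; rewrite !ffunE; case: unliftP => [j' ->|->] //.
by rewrite ffunE.
Qed.

Lemma line_through_site_next i (x : vertex n) :
  line_site i (line_through (dir3 i) x) (x (dir3 i)).+1
  = vertex_site x + step i.
Proof.
rewrite -(line_through_site i); apply/ffunP => j; rewrite site_addE !ffunE.
case: unliftP => [j' e|/lift_inj ->]; last by rewrite eqxx addn1.
case: eqP => [ji|]; last by rewrite addn0.
by have := neq_lift (dir3 i) j'; rewrite -e ji eqxx.
Qed.

Lemma line_through_level i (x : vertex n) :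
  line_through (dir3 i) x ord_max = x ord_max.
Proof.
rewrite ffunE; congr (x _); apply/val_inj => /=.
by rewrite /bump /= /bump; case: i => [[|[|[|]]]].
Qed.

Definition to_fourth sigma x : {poly F} :=
  \sum_i sigma x 0 i * (B (dir3 i) ord_max)%:P.

(** The vertices with fourth coordinate [k] carry the coefficients of [X ^ k].
    On a line along the fourth axis, the first edge gets the feedback times the
    spin of the last edge: this is the boundary condition. *)
Definition unfold_fibre sigma : configuration F n := fun d l k =>
  if unlift ord_max d is Some i
  then coef (l ord_max) (sigma (line_site i l k) 0 i)
  else let w := to_fourth sigma [ffun j => l j : nat] in
    if nat_of_ord k is k'.+1 then coef k' w else feedback * coef (2 ^ n).-1 w.

Lemma unfold_fibre_in sigma (x : vertex n) i :
  spins_in (unfold_fibre sigma) x 0 (dir3 i)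
  = coef (x ord_max) (sigma (vertex_site x) 0 i).
Proof.
rewrite mxE /unfold_fibre /dir3 liftK -/(dir3 i) line_through_level lift_max.
by rewrite line_through_site.
Qed.

Lemma fourth_site (x : vertex n) :
  [ffun j => line_through ord_max x j : nat] = vertex_site x.
Proof. by apply/ffunP => j; rewrite !ffunE. Qed.

Lemma unfold_fibre_in4 sigma (x : vertex n) :
  spins_in (unfold_fibre sigma) x 0 ord_max
  = coef (x ord_max) ('X * to_fourth sigma (vertex_site x)).
Proof.
rewrite mxE /unfold_fibre unlift_none fourth_site.
rewrite wrapped_mulX // -[in RHS](lift_max (x ord_max)).
by case: (nat_of_ord _).
Qed.

Lemma unfold_fibre_permitted sigma :
  octant fibre_brick sigma -> permitted B (unfold_fibre sigma).
Proof.
move=> so x; apply/rowP => d; rewrite [RHS]mxE sum_dir unfold_fibre_in4.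
under eq_bigr do rewrite unfold_fibre_in.
set v := vertex_site x; set k := x ord_max.
elim/ord4_ind: d => [i|]; rewrite mxE /unfold_fibre.
  rewrite /dir3 liftK -/(dir3 i) line_through_level lift0.
  rewrite line_through_site_next so mxE.
  have -> : \sum_j sigma v 0 j * fibre_brick j i
      = \sum_j (B (dir3 j) (dir3 i)) *: sigma v 0 j
        + B ord_max (dir3 i) *: ('X * to_fourth sigma v).
    rewrite /to_fourth mulr_sumr scaler_sumr -big_split.
    apply: eq_bigr => j _ /=.
    by rewrite mxE polyCM -!mul_polyC; ring.
  rewrite wrappedD wrappedZ addrC mulrC; congr (_ + _).
  by rewrite wrapped_sum; apply: eq_bigr => j _; rewrite /= wrappedZ mulrC.
rewrite unlift_none fourth_site lift0 B44 mulr0 add0r wrapped_sum.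
by apply: eq_bigr => j _; rewrite /= mulrC mul_polyC wrappedZ mulrC.
Qed.

Lemma unfold_fibre_boundary sigma : boundary_holds bc (unfold_fibre sigma).
Proof.
rewrite /boundary_holds /unfold_fibre /feedback.
case: bc => l; rewrite unlift_none /=.
  rewrite mul1r; move: (to_fourth _ _) (wrapped _ _) => w g.
  by case: (2 ^ n)%N N_gt0.
by rewrite mul0r.
Qed.

Definition fold_thick i k (f : site -> {poly F}) : thick F n :=
  [ffun l : line n => coef (l ord_max) (f (line_site i l k))].

Lemma input_unfold sigma :
  input (unfold_fibre sigma)
  = [ffun i => fold_thick i 0 (fun x => sigma x 0 i)].
Proof.
by apply/ffunP => i; apply/ffunP => l; rewrite !ffunE /unfold_fibre /dir3 liftK.
Qed.

Lemma output_unfold sigma :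
  output (unfold_fibre sigma)
  = [ffun i => fold_thick i (2 ^ n) (fun x => sigma x 0 i)].
Proof.
by apply/ffunP => i; apply/ffunP => l; rewrite !ffunE /unfold_fibre /dir3 liftK.
Qed.

(** The lines [l] through the same [x] differ by their fourth coordinate only,
    so the sum gathers the entries of [t] above [x] into one polynomial. *)
Definition spread i (t : thick F n) (x : site) : {poly F} :=
  \sum_(l | line_site i l 0 == x) t l *: 'X^(l ord_max).

Lemma line_site_inj i k (l l' : line n) :
  line_site i l k = line_site i l' k -> l ord_max = l' ord_max -> l = l'.
Proof.
move=> /ffunP ll' lmax; apply/ffunP => j'.
have: exists d, d = lift (dir3 i) j' by exists (lift (dir3 i) j').
case; elim/ord4_ind => [j|] e.
  by have := ll' j; rewrite !ffunE e liftK => /ord_inj.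
have -> : j' = ord_max; last exact: lmax.
apply: (@lift_inj _ (dir3 i)); rewrite -e; apply/val_inj => /=.
by rewrite /bump /= /bump; case: (i) => [[|[|[|]]]].
Qed.

Lemma coef_Xn k j : (j < 2 ^ n)%N -> coef k 'X^j = (k == j)%:R.
Proof. by move=> ltj; rewrite wrapped_small ?size_polyXn // coefXn. Qed.

Lemma spreadK i t : fold_thick i 0 (spread i t) = t.
Proof.
apply/ffunP => l; rewrite ffunE wrapped_sum (bigD1 l) //= wrappedZ coef_Xn //.
rewrite eqxx mulr1 big1 ?addr0 // => l' /andP[/eqP e l'l].
rewrite wrappedZ coef_Xn //; case: eqP => [/ord_inj em|]; last by rewrite mulr0.
by rewrite (line_site_inj e (esym em)) eqxx in l'l.
Qed.

(** Propagating the input over [F[X]] gives a configuration for each input, and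
    its uniqueness makes the output linear in the input. *)
Lemma hypercube_operator_exists :
  exists R : 'End(thick3 F n), hypercube_operator B bc R.
Proof.
pose sigma (u : thick3 F n) := evolve fibre_brick (fun i => spread i (u i)).
pose s u := unfold_fibre (sigma u).
have sB u : permitted B (s u) by exact/unfold_fibre_permitted/octant_evolve.
have sbc u : boundary_holds bc (s u) by exact: unfold_fibre_boundary.
have s_in u : input (s u) = u.
  rewrite input_unfold; apply/ffunP => i; rewrite ffunE -[RHS](spreadK i).
  by apply/ffunP => l; rewrite !ffunE evolve_input ?line_site_at.
have lin : linear (fun u => output (s u)).
  move=> a u v /=; rewrite -output_add.
  apply: (output_unique B44) (sB _) (sbc _) _ _ _.
  - exact: add_permitted.
  - exact: add_boundary.
  by rewrite input_add !s_in.
pose Rlin := GRing.isLinear.Build F (thick3 F n) (thick3 F n) _ _ lin.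
pose Rl : {linear thick3 F n -> thick3 F n} :=
  HB.pack (fun u => output (s u)) Rlin.
exists (linfun Rl) => u v; rewrite lfunE /=.
split => [<-|[s' [s'B s'bc s'u <-]]].
  by exists (s u); rewrite s_in.
by apply: (output_unique B44) => //; rewrite s_in.
Qed.

End Unfolding.

(** * The layers *)

(** The dimension of a sum is at most the sum of the dimensions, and these are
    at most [d]: a spanning family as small as the dimension forces equalities. *)
Lemma minimal_spanning_layers (K : fieldType) (vT : vectType K) d N
    (v : 'I_N -> d.-tuple vT) :
  (\sum_k <<v k>>)%VS = fullv -> \dim {:vT} = (N * d)%N ->
  directv (\sum_k <<v k>>) /\ forall k, basis_of <<v k>> (v k).
Proof.
move=> span_v dimT.
have le_d k : (\dim <<v k>> <= d)%N.
  by rewrite (leq_trans (dim_span _)) ?size_tuple.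
have sum_d : (\sum_(k < N) d = N * d)%N by rewrite sum_nat_const card_ord.
have dim_sum : (N * d <= \sum_k \dim <<v k>>)%N.
  by rewrite -dimT -span_v dimv_sum_leqif.
have [le_sum eq_sum] := leqif_sum (fun k (_ : true) => leqif_eq (le_d k)).
have sumE : (\sum_k \dim <<v k>> = N * d)%N.
  by apply/eqP; rewrite eqn_leq dim_sum -sum_d le_sum.
split; first by rewrite directvE /= span_v dimT sumE.
move: eq_sum; rewrite sumE sum_d eqxx => /esym/forallP /= dimE k.
by rewrite /basis_of eqxx /free size_tuple dimE.
Qed.

Section Layers.

Variables (F : fieldType) (n : nat) (B : 'M[F]_4) (bc : boundary).
Hypotheses (F2 : 2%N \in [pchar F]) (B44 : B ord_max ord_max = 0).

Local Notation c := (feedback F bc).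
Local Notation coef := (wrapped (2 ^ n) c).
Local Notation M := (fibre_brick B).

Let N_gt0 : (0 < 2 ^ n)%N. Proof. by rewrite expn_gt0. Qed.

Let cN : c ^+ (2 ^ n) = c.
Proof. by rewrite /feedback; case: bc; rewrite ?expr1n ?expr0n ?expn_eq0. Qed.

Let P2 : 2%N \in [pchar {poly F}]. Proof. by rewrite pchar_poly. Qed.

Definition mode_vector (w : word) i k : thick F n :=
  fold_thick n bc i 0 (fun x => 'X^k * mode w M i x).

Definition layer_brick (b : bool) : 'M[F]_3 :=
  if b then (tildeB n B bc)^T else tildeB n B bc.

Lemma coef_frobenius_brick k b i j p :
  coef k (frobenius_brick n b M i j * p) = layer_brick b i j * coef k p.
Proof.
case: b; rewrite !mxE (wrapped_Frobenius (erefl _) F2 cN);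
  congr (_ ^+ _ * _); rewrite /feedback;
  by case: bc; rewrite ?mulr1 ?mulr0 ?addr0.
Qed.

(** The input [X ^ k] times a mode evolves over [F[X]] into multiples of the
    same mode by polynomials in [X ^ 2 ^ n], which fold to scalars. *)
Lemma operator_mode_vector (R : 'End(thick3 F n)) w i k :
    hypercube_operator B bc R -> size w = n ->
  R (embed i (mode_vector w i k))
  = \sum_j layer_brick (odd (count_mem None w)) i j
           *: embed j (mode_vector w j k).
Proof.
move=> RP wn.
pose inp j (x : site) := if j == i then 'X^k * mode w M i x else 0.
pose sigma := evolve M inp.
have so : octant M sigma := octant_evolve _ _.
apply/RP; exists (unfold_fibre B bc sigma); split.
- exact: unfold_fibre_permitted.
- exact: unfold_fibre_boundary.
- rewrite input_unfold; apply/ffunP => j; rewrite !ffunE.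
  case: eqP => [->|/eqP/negPf ji]; apply/ffunP => l; rewrite !ffunE.
    by rewrite evolve_input ?line_site_at // /inp eqxx.
  by rewrite evolve_input ?line_site_at // /inp ji wrapped0.
rewrite output_unfold; apply/ffunP => j; apply/ffunP => l; rewrite !ffunE.
rewrite !sum_ffunE (bigD1 j) //= !ffunE eqxx big1 ?addr0; last first.
  by move=> j' /negPf j'j; rewrite !ffunE eq_sym j'j ffunE scaler0.
have tr := @mode_transfers _ P2 w M; rewrite wn in tr.
rewrite (tr _ ('X^k *: delta_mx 0 i) so); first last.
- exact: line_site_below.
- exact: line_site_at.
- move=> j' x xj' _; rewrite evolve_input // /inp !mxE eqxx /= eq_sym.
  by case: eqP => [->|]; rewrite ?mulr1 // mulr0 mul0r.
have dep : mode w M j (line_site j l (2 ^ n)) = mode w M j (line_site j l 0).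
  apply: face_dependent_mode => j' j'j; rewrite !ffunE.
  by case: unliftP => // /lift_inj e; rewrite e eqxx in j'j.
rewrite dep -scalemxAl -rowE.
rewrite [X in coef _ (X * _)]mxE [X in coef _ (_ * X * _)]mxE.
by rewrite mulrAC mulrC coef_frobenius_brick [X in _ *: X]ffunE.
Qed.

(** The modulus is [(X - c) ^ 2 ^ n], and [fibre_brick] evaluates at [c] to the
    effective brick. *)
Lemma circulation_fibre_brick :
  brick_nondegenerate B bc -> coprimep (circulation M) (wrap_mod (2 ^ n) c).
Proof.
move=> nondeg; apply: (coprimep_wrap (erefl _) F2 cN).
rewrite /circulation !hornerE.
have d0 : dir3 0 = 0 by apply/val_inj.
have d1 : dir3 1 = 1 by apply/val_inj.
have d2 : dir3 2 = 2 by apply/val_inj.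
have d3 : ord_max = 3 :> 'I_4 by apply/val_inj.
rewrite !mxE !hornerE d0 d1 d2 d3 subr_eq0; apply/eqP.
move: nondeg; rewrite /brick_nondegenerate /feedback; case: bc.
  by rewrite !mulr1.
by rewrite !mulr0 !addr0 => nd e; apply: nd; rewrite e; ring.
Qed.

(** An inverse [d] of the circulation modulo [X ^ 2 ^ n - c] removes the power
    of it in [mode_span]; the powers [X ^ k] come from the reduced coefficients. *)
Lemma thick_spanned i (t : thick F n) : brick_nondegenerate B bc ->
  exists a : 'I_(2 ^ n) -> word -> F,
    t = \sum_k \sum_b \sum_(w <- words b n) a k w *: mode_vector w i k.
Proof.
move=> /circulation_fibre_brick /wrapped_inverse [d dK].
have [e span_e] := mode_span P2 n.
pose around u v : site :=
  [ffun j => if j == i + 1 then u else if j == i + 2 then v else 0%N].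
pose f u v := spread i t (around u v).
have [b bP] := span_e M i f.
exists (fun k w => coef k (d ^+ e * b w)).
apply/ffunP => l; set x := line_site i l 0.
have xE : x = around (x (i + 1)) (x (i + 2)).
  apply/ffunP; elim/(ord3_cycle_ind (i := i));
    by rewrite [RHS]ffunE ?eqxx ?ord3_cycle_eqE // line_site_at.
rewrite -{1}(spreadK bc i t) ffunE -/x xE -/(f _ _) -(dK _ _ e).
rewrite bP; last exact: line_site_below.
rewrite sum_ffunE mulr_sumr wrapped_sum.
under [RHS]eq_bigr do rewrite sum_ffunE.
rewrite [RHS]exchange_big; apply: eq_bigr => p _ /=.
under [RHS]eq_bigr do rewrite sum_ffunE.
rewrite [RHS]exchange_big mulr_sumr wrapped_sum; apply: eq_bigr => w _ /=.
rewrite mulrA wrapped_expand //; apply: eq_bigr => k _.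
by rewrite !ffunE.
Qed.

End Layers.

Lemma embed_sum F n (u : thick3 F n) : u = \sum_i embed i (u i).
Proof.
apply/ffunP => j; rewrite sum_ffunE (bigD1 j) //= ffunE eqxx.
by rewrite big1 ?addr0 // => i /negPf ij; rewrite ffunE eq_sym ij.
Qed.

Lemma embed_is_linear F n i : linear (@embed F n i).
Proof.
move=> a u v; apply/ffunP => j; rewrite !ffunE.
by case: eqP; rewrite ?scaler0 ?addr0.
Qed.

HB.instance Definition _ (F : fieldType) n i :=
  GRing.isLinear.Build F (thick F n) (thick3 F n) _ (@embed F n i)
    (@embed_is_linear F n i).

Theorem proposition20 (F : finFieldType) (n : nat) (B : 'M[F]_4)
    (bc : boundary) :
  2%N \in [pchar F] ->
  (1 <= n)%N ->
  B 3 3 = 0 ->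
  brick_nondegenerate B bc ->
  exists R : 'End(thick3 F n),
    hypercube_operator B bc R /\
    exists W : 'I_3 -> 'I_(2 ^ n) -> {vspace thick F n},
      stratification R W /\
      forall k : 'I_(2 ^ n),
        layer_is_direct_sum R (fun i => W i k)
          (fun m : 'I_((2 ^ (2 * n - 1) + 2 ^ (n - 1))
                       + (2 ^ (2 * n - 1) - 2 ^ (n - 1)))%N =>
             if (m < 2 ^ (2 * n - 1) + 2 ^ (n - 1))%N
             then tildeB n B bc else (tildeB n B bc)^T).
Proof.
move=> F2 n_gt0 B33 nondeg.
have B44 : B ord_max ord_max = 0 by rewrite -B33; congr (B _ _); apply/val_inj.
set d0 := (2 ^ (2 * n - 1) + 2 ^ (n - 1))%N.
set d1 := (2 ^ (2 * n - 1) - 2 ^ (n - 1))%N.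
have d_sum : (d0 + d1 = 4 ^ n)%N.
  have le_d : (2 ^ (n - 1) <= 2 ^ (2 * n - 1))%N by rewrite leq_exp2l //; lia.
  have -> : (4 ^ n = 2 * 2 ^ (2 * n - 1))%N.
    by rewrite -expnS -(expnM 2 2); congr (_ ^ _)%N; lia.
  by rewrite /d0 /d1; lia.
have [size0 size1] : size (words false n) = d0 /\ size (words true n) = d1.
  rewrite /d0 /d1; case: (n) n_gt0 => // m _; have := size_words m.
  by rewrite subSS subn0.
pose ws := words false n ++ words true n.
have size_ws : size ws = (d0 + d1)%N by rewrite size_cat size0 size1.
have [R RP] := hypercube_operator_exists n bc B44.
exists R; split => //.
have [v vE] : exists v : 'I_3 -> 'I_(2 ^ n) -> (d0 + d1).-tuple (thick F n),
    forall i k m, tnth (v i k) m = mode_vector n B bc (nth [::] ws m) i k.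
  exists (fun i k =>
    [tuple mode_vector n B bc (nth [::] ws m) i k | m < d0 + d1]) => i k m.
  by rewrite tnth_mktuple.
have ws_spec (m : 'I_(d0 + d1)) (w := nth [::] ws m) :
    size w = n /\ odd (count_mem None w) = ~~ (m < d0)%N.
  rewrite /w nth_cat size0; case: ltnP => lem; apply: mem_words; apply: mem_nth.
    by rewrite size0.
  by rewrite size1 ltn_subLR.
have R_v i k m : R (embed i (tnth (v i k) m))
    = \sum_j (if (m < d0)%N then tildeB n B bc else (tildeB n B bc)^T) i j
             *: embed j (tnth (v j k) m).
  have [wn wodd] := ws_spec m.
  rewrite vE (operator_mode_vector F2 B44 i k RP wn) wodd /layer_brick.
  by apply: eq_bigr => j _; rewrite vE; case: ltnP.
have span_v i : (\sum_(k < 2 ^ n) <<v i k>>)%VS = fullv.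
  apply/eqP; rewrite eqEsubv subvf; apply/subvP => t _.
  have [a ->] := thick_spanned F2 i t nondeg.
  apply: memv_sumr => k _.
  apply: memv_suml => b _; rewrite big_seq; apply: memv_suml => w wb.
  apply/memvZ/memv_span/(nthP 0).
  have w_ws : w \in ws by rewrite mem_cat; case: b wb => ->; rewrite ?orbT.
  have lt_w : (index w ws < d0 + d1)%N by rewrite -size_ws index_mem.
  exists (index w ws); rewrite ?size_tuple //.
  by rewrite -(tnth_nth 0 _ (Ordinal lt_w)) vE /= nth_index.
have dimT : \dim {:thick F n} = (2 ^ n * (d0 + d1))%N.
  rewrite dimvf /dim /= card_ffun !card_ord d_sum muln1.
  by rewrite -(expnM 2 2) -expnM -expnD; congr (2 ^ _)%N; lia.
have layers i := minimal_spanning_layers (span_v i) dimT.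
exists (fun i k => <<v i k>>%VS); split.
  split=> //.
  - by move=> i; case: (layers i).
  - move=> i k; have [_ /(_ k) b] := layers i.
    exact: etrans (size_basis b) d_sum.
  move=> k u uW i.
  rewrite [u]embed_sum linear_sum sum_ffunE; apply: memv_suml => j _.
  rewrite (coord_span (uW j)) !linear_sum sum_ffunE; apply: memv_suml => m _.
  rewrite !linearZ ffunE -tnth_nth /= R_v; apply: memvZ.
  rewrite sum_ffunE; apply: memv_suml => j' _; rewrite !ffunE.
  case: eqP => [->|_]; last by rewrite scaler0 mem0v.
  by apply/memvZ/memv_span/mem_tnth.
by move=> k; exists (fun i => v i k); split=> // i; have [_] := layers i.
Qed.
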